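(* Let $m,n$ be positive integers and $d=m-n$. If $d\le 0$, then $S(m,n,z)=S(m,n)$ for all $z\in\mathbb{C}$. If $d>0$, then for $z\in\mathbb{C}$ the equation $S(m,n,z)=S(m,n)$ holds if and only if $z$ is a root of the polynomial $$P_{(m,n)}(z)=\sum_{j=1}^{d}\binom{m}{j}S(m-j,n)(-z)^{j}.$$
   Context: $S(m,n)$ denotes the Stirling number of the second kind (the number of partitions of an $m$-element set into $n$ nonempty subsets; it is $0$ if $m<n$). For positive integers $m,n$, with $d=m-n$, and $z\in\mathbb{C}$, the Stirling function is $$S(m,n,z)=\frac{(-1)^{d}}{n!}\sum_{k=0}^{n}\binom{n}{k}(-1)^{k}(z-k)^{m}.$$ *)

(* Defs.v *)
From HB Require Import structures.
From mathcomp Require Import all_boot all_order all_algebra.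
From mathcomp Require Import reals.
From mathcomp Require Import complex.

Set Implicit Arguments.
Unset Strict Implicit.
Unset Printing Implicit Defensive.

Import GRing.Theory Num.Theory.
Local Open Scope ring_scope.

(* [partition] requires the blocks to be nonempty. *)
Definition stirling2 (m n : nat) : nat :=
  #|[set P : {set {set 'I_m}} | partition P [set: 'I_m] && (#|P| == n)]|.

(* d = m - n is taken in int, since it may be negative here; [^] is
   exponentiation with an integer exponent. *)
Definition stirling_fun (R : realType) (m n : nat) (z : R[i]) : R[i] :=
  (-1) ^ (m%:Z - n%:Z) / (n`!)%:R *
    \sum_(0 <= k < n.+1) 'C(n, k)%:R * (-1) ^+ k * (z - k%:R) ^+ m.

(* The index j runs from 1 to d = m - n; the truncated subtractions are exact
   in the case n < m where this polynomial is used. *)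
Definition stirling_poly (R : realType) (m n : nat) : {poly R[i]} :=
  \sum_(1 <= j < (m - n).+1)
    ('C(m, j)%:R * (stirling2 (m - j) n)%:R) *: (- 'X) ^+ j.

(* Main.v *)
Require Import Defs.
From mathcomp Require Import all_boot all_order all_algebra.
From mathcomp Require Import reals.
From mathcomp Require Import complex.
From mathcomp Require Import zify ring.

(** Expand [(z - k) ^+ m] by the binomial theorem and exchange the two sums.
    The coefficient of [(- z) ^+ j] becomes ['C(m, j)] times an [n]-th finite
    difference at [0] of the power function of exponent [m - j], divided by
    [n`!]; such a difference is [n`! * S(m - j, n)].  Hence
      [S(m, n, z) = \sum_(0 <= j <= m) 'C(m, j) * S(m - j, n) * (- z) ^+ j].
    The term [j = 0] is [S(m, n)], and the terms with [j > m - n] vanish since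
    a set with fewer than [n] elements has no partition into [n] blocks; what
    is left between these is [P_(m,n)(z)], an empty sum when [m <= n].

    The finite differences of powers are found by counting functions
    ['I_m -> 'I_k] according to their kernel, the partition of ['I_m] into
    fibres: a function with kernel [P] is an injective labelling of the blocks
    of [P], so [k ^ m] is the sum of [k ^_ #|P|] over all partitions [P]
    (lemma [expn_sum_ffact]).  The [n]-th difference at [0] of the falling
    factorial [k ^_ i] is [n`!] if [i = n] and [0] otherwise (lemma
    [alternating_sum_ffact]), so it selects the partitions into [n] blocks. *)

Set Implicit Arguments.
Unset Strict Implicit.
Unset Printing Implicit Defensive.

Import GRing.Theory Num.Theory.
Local Open Scope ring_scope.

Section KernelPartitions.

Variable T : finType.
Implicit Type P : {set {set T}}.

Lemma preim_partition_eq_iff (S : eqType) (f : T -> S) P :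
  partition P [set: T] ->
  preim_partition f [set: T] = P <->
  (forall x y, (f x == f y) = (y \in pblock P x)).
Proof.
move=> partP; split=> [<- x y | eq_f].
  by rewrite pblock_equivalence_partition ?in_setT // => a b c _ _ _;
     split=> // /eqP->.
rewrite -[RHS](equivalence_partition_pblock partP).
by apply: eq_imset => x; apply/setP => y; rewrite !inE eq_f.
Qed.

(** Composing with the block map [pblock P] is a bijection from the injective
    labellings of the blocks onto the functions with kernel [P]: it is
    injective because no block is empty, and a function with kernel [P] is
    recovered from its values at one chosen point of each block. *)
Lemma card_ffun_kernel k P :
  partition P [set: T] ->
  #|[set f : {ffun T -> 'I_k} | preim_partition f [set: T] == P]|
    = (k ^_ #|P|)%N.
Proof.
move=> partP; have [/eqP covP trivP P0] := and3P partP.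
have in_blk x : pblock P x \in P by rewrite pblock_mem ?covP.
pose blk x : {B : {set T} | B \in P} := Sub (pblock P x) (in_blk x).
have ex_pt (B : {B : {set T} | B \in P}) : exists x, x \in val B.
  by apply/set0Pn; apply: contraNneq P0 => <-; exact: valP.
pose pt B := xchoose (ex_pt B).
have blk_pt B : blk (pt B) = B.
  apply/val_inj/def_pblock => //; [exact: valP | exact: xchooseP].
have eq_blk x y : (blk x == blk y) = (y \in pblock P x).
  by rewrite -val_eqE /= eq_pblock ?covP.
pose label (g : {ffun {B : {set T} | B \in P} -> 'I_k}) := [ffun x => g (blk x)].
have label_inj : injective label.
  move=> g1 g2 /ffunP eq_g; apply/ffunP => B.
  by have := eq_g (pt B); rewrite !ffunE blk_pt.
rewrite -[#|P|]card_sig -[X in (X ^_ _)%N]card_ord -card_inj_ffuns.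
rewrite -(card_imset _ label_inj); apply: eq_card => f; rewrite inE.
apply/eqP/imsetP => [/(preim_partition_eq_iff _ partP) kerf | [g]].
  exists [ffun B => f (pt B)]; last first.
    apply/ffunP => x; rewrite !ffunE; apply/eqP.
    by rewrite kerf -eq_blk blk_pt.
  rewrite inE; apply/injectiveP => B C; rewrite !ffunE => /eqP.
  by rewrite kerf -eq_blk !blk_pt => /eqP.
rewrite inE => /injectiveP g_inj ->; apply/(preim_partition_eq_iff _ partP).
by move=> x y; rewrite !ffunE (inj_eq g_inj) eq_blk.
Qed.

Lemma expn_sum_ffact k :
  (k ^ #|T| = \sum_(P : {set {set T}} | partition P [set: T]) k ^_ #|P|)%N.
Proof.
rewrite -[in LHS](card_ord k) -card_ffun -sum1_card.
rewrite (partition_big (fun f : {ffun T -> 'I_k} => preim_partition f [set: T])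
           (fun P => partition P [set: T])) /=; last first.
  by move=> f _; exact: preim_partitionP.
apply: eq_bigr => P partP; rewrite -(card_ffun_kernel k partP) -sum1_card.
by apply: eq_bigl => f; rewrite inE.
Qed.

End KernelPartitions.

Lemma stirling2_small m n : (m < n)%N -> stirling2 m n = 0%N.
Proof.
move=> lt_mn; apply/eqP; rewrite cards_eq0; apply/eqP/setP => P; rewrite !inE.
apply: contraTF lt_mn => /andP[partP /eqP <-]; rewrite -leqNgt.
rewrite -[leqRHS]card_ord -cardsT (card_partition partP) -sum1_card.
apply: leq_sum => B PB; rewrite card_gt0.
by apply: contraTneq PB => ->; case/and3P: partP.
Qed.

Section AlternatingSums.

Variable R : comPzRingType.

(** Induction on [n] and [i] together: for [k > 0] the absorption identity
    turns the [k]-th term for [n.+1] and [i.+1] into [- n.+1] times the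
    [k.-1]-th term for [n] and [i].  For [i = 0] the sum is [(1 - 1) ^+ n]. *)
Lemma alternating_sum_ffact n i :
  \sum_(k < n.+1) 'C(n, k)%:R * (-1) ^+ k * (k ^_ i)%:R
    = ((i == n) * n`!)%:R * (-1) ^+ n :> R.
Proof.
elim: n i => [|n IHn] [|i].
- by rewrite big_ord1 bin0 ffactn0 !mulr1.
- by rewrite big_ord1 ffact0n /= mulr0 mul0r.
- rewrite /= mul0n mul0r.
  transitivity ((1 - 1 : R) ^+ n.+1); last by rewrite subrr expr0n.
  rewrite exprDn; apply: eq_bigr => k _.
  by rewrite expr1n mul1r ffactn0 mulr1 mulr_natl.
rewrite big_ord_recl ffact0n /= mulr0 add0r.
transitivity (- n.+1%:R *
    \sum_(k < n.+1) 'C(n, k)%:R * (-1) ^+ k * (k ^_ i)%:R : R).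
  rewrite mulr_sumr; apply: eq_bigr => k _.
  have binE : n.+1%:R * 'C(n, k)%:R = k.+1%:R * 'C(n.+1, k.+1)%:R :> R.
    by rewrite -!natrM mul_bin_diag.
  rewrite /bump /= add1n ffactSS exprS natrM.
  by rewrite !(mulNr, mulN1r, mulrN) !mulrA binE; congr (- _); ring.
by rewrite IHn eqSS factS exprS !natrM; ring.
Qed.

(** The factor [(-1) ^+ n] appears because the [n]-th difference at [0] carries
    the signs [(-1) ^+ (n - k)].  After [k ^ m] is expanded over the partitions
    of ['I_m], only those with exactly [n] blocks contribute. *)
Lemma alternating_sum_expn m n :
  \sum_(k < n.+1) 'C(n, k)%:R * (-1) ^+ k * (k ^ m)%:R
    = (n`! * stirling2 m n)%:R * (-1) ^+ n :> R.
Proof.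
under eq_bigr => k _.
  rewrite -[X in (_ ^ X)%N]card_ord expn_sum_ffact natr_sum mulr_sumr; over.
rewrite exchange_big /=.
under eq_bigr => P _ do rewrite alternating_sum_ffact.
rewrite -mulr_suml -natr_sum -big_distrl /= mulnC; congr ((_ * _)%:R * _).
rewrite /stirling2 -sum1_card big_mkcond [RHS]big_mkcond /=.
by apply: eq_bigr => P _; rewrite inE; do 2!case: ifP => //.
Qed.

End AlternatingSums.

Lemma stirling_funE (R : realType) m n (z : R[i]) :
  stirling_fun m n z =
    \sum_(0 <= j < m.+1) 'C(m, j)%:R * (stirling2 (m - j) n)%:R * (- z) ^+ j.
Proof.
rewrite /stirling_fun !big_mkord.
have sgn2 p : (-1) ^+ p * (-1) ^+ p = 1 :> R[i].
  by rewrite -expr2 sqrr_sign.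
have -> : (-1) ^ (m%:Z - n%:Z) = (-1) ^+ m * (-1) ^+ n :> R[i].
  by rewrite expfzDr ?oppr_eq0 ?oner_eq0 // -exprnN invr_sign.
(* Writing [z - k] as [- (k - z)] makes the sign [(-1) ^+ m] global. *)
have powE k : (z - k%:R) ^+ m =
    (-1) ^+ m * \sum_(j < m.+1) k%:R ^+ (m - j) * (- z) ^+ j *+ 'C(m, j).
  by rewrite -exprDn -exprNn opprB.
under eq_bigr => k _ do rewrite powE mulrCA mulr_sumr.
rewrite -mulr_sumr exchange_big /= !mulr_sumr.
apply: eq_bigr => j _.
transitivity ((-1) ^+ n / n`!%:R * ('C(m, j)%:R * (- z) ^+ j) *
    \sum_(k < n.+1) 'C(n, k)%:R * (-1) ^+ k * (k ^ (m - j))%:R :> R[i]).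
  rewrite -[(-1) ^+ m * _ / _]mulrA mulrACA sgn2 mul1r -mulrA.
  congr (_ * _); rewrite mulr_sumr; apply: eq_bigr => k _.
  by rewrite natrX -[_ *+ 'C(m, j)]mulr_natl; ring.
rewrite alternating_sum_expn natrM.
have nz : n`!%:R != 0 :> R[i] by rewrite pnatr_eq0 -lt0n fact_gt0.
transitivity ((-1) ^+ n * (-1) ^+ n * (n`!%:R / n`!%:R) *
  ('C(m, j)%:R * (stirling2 (m - j) n)%:R * (- z) ^+ j) : R[i]); first by ring.
by rewrite sgn2 divff // !mul1r.
Qed.

Lemma stirling_funE_poly (R : realType) m n (z : R[i]) :
  stirling_fun m n z = (stirling2 m n)%:R + (stirling_poly R m n).[z].
Proof.
rewrite stirling_funE big_nat_recl // bin0 subn0 expr0 mul1r mulr1.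
congr (_ + _); rewrite /stirling_poly horner_sum big_add1 /=.
rewrite (big_cat_nat (n := m - n)) ?leq_subr //= [X in _ + X]big_nat.
rewrite [X in _ + X]big1 ?addr0; last first.
  by move=> j /andP[le_j lt_j]; rewrite stirling2_small ?mulr0 ?mul0r //; lia.
by apply: eq_bigr => j _; rewrite !hornerE.
Qed.

Theorem proposition1 (R : realType) (m n : nat)
    (hm : (0 < m)%N) (hn : (0 < n)%N) :
  let d : int := m%:Z - n%:Z in
  (d <= 0 -> forall z : R[i], stirling_fun m n z = (stirling2 m n)%:R) /\
  (0 < d -> forall z : R[i],
     stirling_fun m n z = (stirling2 m n)%:R <-> root (stirling_poly R m n) z).
Proof.
move=> d; split=> [le_d0 z | _ z]; rewrite stirling_funE_poly.
  have /eqP mn0 : (m - n == 0)%N by rewrite subn_eq0 -lez_nat -subr_le0.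
  by rewrite /stirling_poly mn0 big_geq // horner0 addr0.
rewrite /root; split=> [/eqP | /eqP ->]; last by rewrite addr0.
by rewrite -subr_eq0 addrC addKr.
Qed.
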